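(* Let $C\subseteq\mathbb{R}^n$ be nonempty, closed and convex, and let $h:\mathbb{R}^n\to\mathbb{R}$ be locally Lipschitz, bounded below on $C$, and such that the directional derivative $h'(x;d)=\lim_{t\downarrow 0}\frac{h(x+td)-h(x)}{t}$ exists for every $x\in C$ and every $d\in\mathbb{R}^n$. Let $\{x^k\}_{k\ge 0}$ be generated by the augmented algorithm described in the context, started at $x^0\in C$, with parameters $\gamma>0$ and $r\in(0,\infty)$, and with any oracle $\mathcal{O}_C$ that produces feasible points $z^{k+1}\in C$. Then: (i) $\sum_{k=0}^{\infty}(t^k_{ex})^2<\infty$, and in particular $t^k_{ex}\to 0$. (ii) Almost surely, every accumulation point of $\{x^k\}$ is d-stationary for the problem $\min_{x\in C}h(x)$.
   Context: Notation. $L:=\operatorname{aff}(C-x^0)$ for any $x^0\in C$ is the linear subspace parallel to the affine hull of $C$ (independent of the choice of $x^0\in C$). $S^{n-1}$ is the Euclidean unit sphere in $\mathbb{R}^n$. d-stationarity. For $\bar x\in C$ the cone of feasible directions is $D_C(\bar x):=\{w\in\mathbb{R}^n : \exists\,\lambda>0,\ \bar x+\lambda w\in C\}$. A point $\bar x\in C$ is d-stationary for $\min_{x\in C}h(x)$ if $h'(\bar x;d)\ge 0$ for all $d\in D_C(\bar x)$. Augmented algorithm. Given $x^0\in C$, an oracle $\mathcal{O}_C$ returning points of $C$, $\gamma>0$ and $r\in(0,\infty)$, for $k=0,1,2,\dots$: 1. Sample $v^k_{ex}\sim\mathcal{D}_v$ and $\hat t^k\sim\mathcal{D}_t$. 2.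 Set $t^k_{ex}:=\hat t^k$ if $x^k+\hat t^k v^k_{ex}\in C$ and $h(x^k+\hat t^k v^k_{ex})+\frac{\gamma}{2}(\hat t^k)^2<h(x^k)$, and $t^k_{ex}:=0$ otherwise. Set $y^{k+1}:=x^k+t^k_{ex}v^k_{ex}$. 3. Set $z^{k+1}:=\mathcal{O}_C(x^k)\in C$. 4. Choose $x^{k+1}\in\arg\min_{u\in\{y^{k+1},z^{k+1}\}}h(u)$. Sampling assumptions. $\mathcal{D}_v$ is a probability distribution with support $S^{n-1}\cap L$ that assigns strictly positive probability to every measurable subset of $S^{n-1}\cap L$ of strictly positive surface measure. $\mathcal{D}_t$ is a probability distribution with support $[0,r]$ that assigns positive probability to every interval $[a,b]\subseteq(0,r]$ with $a<b$. The pairs $(v^k_{ex},\hat t^k)$, $k\ge0$, are i.i.d.; for each $k$, $v^k_{ex}$ and $\hat t^k$ are independent of each other, and $(v^k_{ex},\hat t^k)$ is independent of the past, i.e. of the $\sigma$-algebra generated by $x^0,v^0_{ex},\hat t^0,\dots,x^{k-1},v^{k-1}_{ex},\hat t^{k-1},x^k$. All iterates are random vectors (measurable). If $C$ is a singleton (so that $S^{n-1}\cap L=\emptyset$), nothing is sampled and one sets $t^k_{ex}:=0$, $y^{k+1}:=x^k$. *)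

(* Defs.v *)
From HB Require Import structures.
From mathcomp Require Import all_boot all_order all_algebra.
From mathcomp Require Import all_classical all_reals all_analysis.

Set Implicit Arguments.
Unset Strict Implicit.
Unset Printing Implicit Defensive.

Import Order.TTheory GRing.Theory Num.Theory.
Import numFieldNormedType.Exports.

Local Open Scope classical_set_scope.
Local Open Scope ring_scope.

(* R^n is 'rV[R]_n. The norm `|_| that the library puts on 'rV[R]_n is the sup
   norm; it induces the Euclidean topology and the same locally Lipschitz
   functions, so it serves for closedness, accumulation points and local
   Lipschitz continuity. [enorm] is used where the Euclidean norm itself
   matters: the unit sphere and its surface measure. *)
Definition enorm (R : realType) (n : nat) (u : 'rV[R]_n) : R :=
  Num.sqrt (\sum_(i < n) (u ord0 i) ^+ 2).

Notation borel_rV R n := (g_sigma_algebraType (@open 'rV[R]_n)).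

Section Geometry.
Context {R : realType} {n : nat}.
Implicit Types (A C L U : set 'rV[R]_n).

Definition affine_hull A : set 'rV[R]_n :=
  [set w | exists (m : nat) (a : 'I_m -> R) (c : 'I_m -> 'rV[R]_n),
     [/\ forall i, A (c i), \sum_(i < m) a i = 1
       & w = \sum_(i < m) a i *: c i]].

(* aff(C - x0) is the same set for all x0 in C. *)
Definition parallel_subspace C : set 'rV[R]_n :=
  [set w | exists2 x0, C x0 & affine_hull [set c - x0 | c in C] w].

Definition sphere_in L : set 'rV[R]_n := [set u | L u /\ enorm u = 1].

(* The largest size of a linearly independent family in L, i.e. the dimension
   of L when L is a linear subspace. *)
Definition lin_dim L : nat :=
  (\max_(m < n.+1 | `[< exists2 M : 'M[R]_(m, n),
      row_free M & forall i, L (row i M) >]) m)%N.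

Definition diameter U : \bar R :=
  ereal_sup [set (enorm (u - w))%:E | u in U & w in U].

(* Volume of the unit ball of R^s, V_s = (2 pi / s) V_(s-2). *)
Fixpoint unit_ball_volume (s : nat) : R :=
  match s with
  | 0%N => 1
  | 1%N => 2
  | (s'.+1 as p).+1 => 2 * pi / p.+1%:R * unit_ball_volume s'
  end.

(* The case distinction makes the empty set weigh 0 also when s = 0. *)
Definition hausdorff_weight (s : nat) U : \bar R :=
  (if `[< U = set0 >] then 0
   else (unit_ball_volume s / 2 ^+ s)%:E * diameter U ^+ s)%E.

Definition hausdorff_content (s : nat) (delta : R) A : \bar R :=
  ereal_inf [set (\sum_(0 <= i <oo) hausdorff_weight s (U i))%E
    | U in [set U : (set 'rV[R]_n)^nat |
        A `<=` \bigcup_i U i /\ forall i, (diameter (U i) <= delta%:E)%E]].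

Definition hausdorff_measure (s : nat) A : \bar R :=
  ereal_sup [set hausdorff_content s delta A | delta in [set delta | 0 < delta]].

(* The unit sphere of a d-dimensional subspace is a (d-1)-dimensional
   submanifold, whose surface measure is the Hausdorff measure H^(d-1)
   (counting measure when d = 1). *)
Definition surface_measure L A : \bar R :=
  hausdorff_measure (lin_dim L).-1 A.

End Geometry.

Section DStationarity.
Context {R : realType} {n : nat}.
Implicit Types (C : set 'rV[R]_n) (h : 'rV[R]_n -> R) (x d : 'rV[R]_n).

Definition diff_quotient h x d (t : R) : R := (h (x + t *: d) - h x) / t.

Definition has_dir_deriv h x d : Prop :=
  cvg (diff_quotient h x d t @[t --> 0^'+]).

Definition dir_deriv h x d : R := lim (diff_quotient h x d t @[t --> 0^'+]).

Definition feasible_directions C x : set 'rV[R]_n :=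
  [set w | exists2 lambda : R, 0 < lambda & C (x + lambda *: w)].

Definition d_stationary C h x : Prop :=
  C x /\ forall d, feasible_directions C x d -> 0 <= dir_deriv h x d.

End DStationarity.

Definition argmin {R : realType} {T : Type} (h : T -> R) (S : set T) : set T :=
  [set u | S u /\ forall w, S w -> h u <= h w].

Definition measure_support {T : topologicalType} {R : realType}
    (mu : set T -> \bar R) : set T :=
  [set x | forall U, open U -> U x -> (0 < mu U)%E].

Definition is_singleton {T : Type} (A : set T) : Prop := exists a, A = [set a].

Section Independence.
Context {d : measure_display} {Omega : measurableType d} {R : realType}.
Variable P : probability Omega R.

Definition independent_systems (F G : set_system Omega) : Prop :=
  forall A B, F A -> G B -> (P (A `&` B) = P A * P B)%E.

Definition mutually_independent (F : nat -> set_system Omega) : Prop :=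
  forall (s : seq nat) (E : nat -> set Omega), uniq s ->
    (forall i, i \in s -> F i (E i)) ->
    P (\bigcap_(i in [set` s]) E i) = (\prod_(i <- s) P (E i))%E.

End Independence.

Section Algorithm.
Context {d : measure_display} {Omega : measurableType d} {R : realType}
  {n : nat}.

Implicit Types (x y z v : nat -> Omega -> 'rV[R]_n) (that tex : nat -> Omega -> R).

(* The oracle may depend on the iteration and be randomized; a deterministic
   map u |-> O_C(u) is the special case where oracle ignores k and omega. *)
Record augmented_run (C : set 'rV[R]_n) (h : 'rV[R]_n -> R) (gamma : R)
    (oracle : nat -> Omega -> 'rV[R]_n -> 'rV[R]_n) x y z v that tex : Prop := {
  run_init : forall omega, C (x 0%N omega) ;
  run_tex : forall k omega, tex k omega =
    if `[< is_singleton C >] then 0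
    else if `[< C (x k omega + that k omega *: v k omega) /\
                h (x k omega + that k omega *: v k omega)
                  + gamma / 2 * that k omega ^+ 2 < h (x k omega) >]
    then that k omega else 0 ;
  run_y : forall k omega,
    y k.+1 omega = x k omega + tex k omega *: v k omega ;
  run_z : forall k omega, z k.+1 omega = oracle k omega (x k omega) ;
  run_x : forall k omega,
    argmin h [set y k.+1 omega; z k.+1 omega] (x k.+1 omega) }.

Definition random_vector (X : Omega -> 'rV[R]_n) : Prop :=
  measurable_fun [set: Omega] (X : Omega -> borel_rV R n).

Definition random_real (X : Omega -> R) : Prop :=
  measurable_fun [set: Omega] (X : Omega -> measurableTypeR R).

Definition sigma_vec (X : Omega -> 'rV[R]_n) : set_system Omega :=
  g_sigma_algebra_preimage (X : Omega -> borel_rV R n).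

Definition sigma_real (X : Omega -> R) : set_system Omega :=
  g_sigma_algebra_preimage (X : Omega -> measurableTypeR R).

Definition sample_pair v that (k : nat) :
    Omega -> (borel_rV R n * measurableTypeR R)%type :=
  fun omega => (v k omega, that k omega).

Definition past_sigma x v that (k : nat) : set_system Omega :=
  <<s \bigcup_(j in [set j | (j <= k)%N]) sigma_vec (x j)
      `|` \bigcup_(j in [set j | (j < k)%N])
            (sigma_vec (v j) `|` sigma_real (that j)) >>.

Record sampling_assumptions (P : probability Omega R) (C : set 'rV[R]_n)
    (r : R) (Dv : probability (borel_rV R n) R)
    (Dt : probability (measurableTypeR R) R) x v that : Prop := {
  Dv_support : measure_support (Dv : set 'rV[R]_n -> \bar R) =
    sphere_in (parallel_subspace C) ;
  Dv_pos : forall A : set (borel_rV R n), measurable A ->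
    A `<=` sphere_in (parallel_subspace C) ->
    (0 < surface_measure (parallel_subspace C) A)%E -> (0 < Dv A)%E ;
  Dt_support : measure_support (Dt : set R -> \bar R) = `[0, r]%classic ;
  Dt_pos : forall a b : R, 0 < a -> a < b -> b <= r ->
    (0 < Dt `[a, b]%classic)%E ;
  v_measurable : forall k, random_vector (v k) ;
  that_measurable : forall k, random_real (that k) ;
  v_law : forall k (A : set (borel_rV R n)), measurable A ->
    P (v k @^-1` A) = Dv A ;
  that_law : forall k (B : set (measurableTypeR R)), measurable B ->
    P (that k @^-1` B) = Dt B ;
  pairs_identically_distributed :
    forall k l (E : set (borel_rV R n * measurableTypeR R)), measurable E ->
    P (sample_pair v that k @^-1` E) = P (sample_pair v that l @^-1` E) ;
  pairs_independent : mutually_independent P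
    (fun k => g_sigma_algebra_preimage (sample_pair v that k)) ;
  v_that_independent : forall k,
    independent_systems P (sigma_vec (v k)) (sigma_real (that k)) ;
  pair_past_independent : forall k, independent_systems P
    (g_sigma_algebra_preimage (sample_pair v that k)) (past_sigma x v that k) }.

End Algorithm.

(* Main.v *)
Require Import Defs.
From HB Require Import structures.
From mathcomp Require Import all_boot all_order all_algebra.
From mathcomp Require Import all_classical all_reals all_analysis.
From mathcomp Require Import ring lra.
Import Order.TTheory GRing.Theory Num.Theory.
Import numFieldNormedType.Exports.
Local Open Scope classical_set_scope.
Local Open Scope ring_scope.

(* (i) Every step gives [h (x k.+1) + gamma / 2 * tex k ^+ 2 <= h (x k)], and
   [h] is bounded below on [C], so the sum telescopes.

   (ii) Let [xbar] be a point of [C] that is not d-stationary. A feasible descent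
   direction at [xbar], tilted slightly towards a relative interior point of [C],
   yields a unit direction and a step length whose trial point is accepted with
   room to spare; so every sample from some neighborhood [V x T] of them is
   accepted from every iterate in some neighborhood [U] of [xbar]. As the samples
   are independent of the past and hit [V x T] with positive probability, almost
   surely infinitely many visits to [U] entail infinitely many accepted steps
   bounded away from 0, contradicting (i). Balls with rational centers and radii
   reduce this to countably many null sets. *)

(** * Convex combinations, the parallel subspace and relative interior points *)

Section RelativeInterior.
Context {R : realType} {n : nat}.
Implicit Types (C : set 'rV[R]_n) (x : 'rV[R]_n).

Lemma convex_setP {C x} {w : 'rV[R]_n} (a : R) :
  @convex_set R 'rV[R]_n C -> C x -> C w -> 0 <= a <= 1 ->
  C (x + a *: (w - x)).
Proof.
move=> Ccvx Cx Cw /andP[a0 a1].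
have := Ccvx w x (Itv01 a0 a1) (mem_set Cw) (mem_set Cx).
rewrite inE /conv/=; congr C.
by rewrite scalerBr scalerBl scale1r addrCA.
Qed.

(** The weight missing from 1 sits on [x]. Once the first point is split off, the rest is a
    subcombination with weights divided by [1 - b], and the whole is a point of the segment between
    the two. *)
Lemma convex_subcombination {C x} {m : nat} (a : 'I_m -> R)
    (c : 'I_m -> 'rV[R]_n) :
  @convex_set R 'rV[R]_n C -> C x -> (forall i, C (c i)) ->
  (forall i, 0 <= a i) -> \sum_i a i <= 1 ->
  C (x + \sum_i a i *: (c i - x)).
Proof.
move=> Ccvx Cx; elim: m a c => [|m IH] a c Cc a0 a1.
  by rewrite big_ord0 addr0.
rewrite big_ord_recl; set b := a ord0; set s := \sum_(i < m) _.
have b0 : 0 <= b by exact: a0.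
have tail : \sum_(i < m) a (lift ord0 i) <= 1 - b.
  by move: a1; rewrite big_ord_recl -/b; lra.
have [b1|b1] := ltP b 1; last first.
  have z i : a (lift ord0 i) = 0.
    apply/eqP; rewrite eq_le a0 andbT.
    have : a (lift ord0 i) <= \sum_(i < m) a (lift ord0 i).
      by rewrite (bigD1 i)//= lerDl sumr_ge0.
    lra.
  rewrite /s big1 => [|i _]; last by rewrite z scale0r.
  rewrite addr0; apply: convex_setP => //.
  rewrite b0 (le_trans _ a1)//.
  by rewrite big_ord_recl lerDl sumr_ge0.
have b1' : 1 - b != 0 by rewrite subr_eq0 gt_eqF.
have Ct : C (x + \sum_(i < m) (a (lift ord0 i) / (1 - b)) *:
                   (c (lift ord0 i) - x)).
  apply: IH => [i|i|]; [exact: Cc| |].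
    by rewrite divr_ge0// subr_ge0 ltW.
  by rewrite -mulr_suml ler_pdivrMr ?subr_gt0// mul1r.
have -> : x + (b *: (c ord0 - x) + s) =
    (x + \sum_(i < m) (a (lift ord0 i) / (1 - b)) *: (c (lift ord0 i) - x))
    + b *: (c ord0 - (x + \sum_(i < m) (a (lift ord0 i) / (1 - b)) *:
                   (c (lift ord0 i) - x))).
  have -> : \sum_(i < m) (a (lift ord0 i) / (1 - b)) *: (c (lift ord0 i) - x)
      = (1 - b)^-1 *: s.
    by rewrite scaler_sumr; apply: eq_bigr => i _; rewrite scalerA mulrC.
  apply/rowP => j; rewrite !mxE; field.
  exact: b1'.
by apply: convex_setP => //; rewrite b0 ltW.
Qed.

(** A family of differences of maximal rank does it: appending the row [c - x] cannot raise the
    rank, so that row already lies in the row space. *)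
Lemma exists_spanning_differences {C x} : C x ->
  exists (m : nat) (M : 'M[R]_(m, n)),
    (forall i, C (x + row i M)) /\
    (forall c, C c -> (c - x <= M)%MS).
Proof.
move=> Cx.
pose Q k := `[< exists (m : nat) (M : 'M[R]_(m, n)),
    (forall i, C (x + row i M)) /\ \rank M = k >].
have exQ : exists k, Q k.
  exists 0%N; apply/asboolP; exists 0%N, 0; split; last exact: mxrank0.
  by case.
have ubQ k : Q k -> (k <= n)%N.
  by move=> /asboolP[m [M [_ <-]]]; exact: rank_leq_col.
case: (ex_maxnP exQ ubQ) => k /asboolP[m [M [CM rM]]] kmax.
exists m, M; split=> // c Cc.
pose N := col_mx M (c - x).
have CN i : C (x + row i N).
  have [j ->|j ->] := split_ordP i; first by rewrite rowKu.
  by rewrite rowKd row_id addrC subrK.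
have rN : (\rank N <= \rank M)%N.
  by rewrite rM; apply: kmax; apply/asboolP; exists (m + 1)%N, N.
have MN : (M <= N)%MS by rewrite -addsmxE addsmxSl.
have /eqmxP eMN : (M == N)%MS.
  by rewrite -(geq_leqif (mxrank_leqif_eq MN)).
by rewrite eMN -addsmxE addsmxSr.
Qed.

Lemma ler_norm_coord (w : 'rV[R]_n) (j : 'I_n) : `|w ord0 j| <= `|w|.
Proof.
rewrite [leRHS]mx_normrE.
exact: (le_bigmax _ (fun p : 'I_1 * 'I_n => `|w p.1 p.2|) (ord0, j)).
Qed.

(** This trades affine hulls for a row space. A difference [c - x0] with another base point is
    [(c - x) - (x0 - x)]. *)
Lemma parallel_subspaceE {C x} {m : nat} {M : 'M[R]_(m, n)} :
  C x -> (forall i, C (x + row i M)) -> (forall c, C c -> (c - x <= M)%MS) ->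
  parallel_subspace C = [set w : 'rV[R]_n | (w <= M)%MS].
Proof.
move=> Cx CM spanM; apply/seteqP; split=> w /=.
  move=> [x0 Cx0 [k [a [c [Cc a1 ->]]]]].
  apply: summx_sub => i _; apply: scalemx_sub.
  have [ci Cci <-] := Cc i.
  rewrite (_ : ci - x0 = (ci - x) - (x0 - x)); last first.
    by rewrite opprB addrA subrK.
  by apply: addmx_sub; [exact: spanM|rewrite eqmx_opp; exact: spanM].
move=> /submxP[u ->]; exists x => //.
(* The leftover weight goes to the zero difference [x - x], which turns a linear combination of the
   rows into an affine one. *)
exists m.+1,
  (fun i => if unlift ord0 i is Some j then u 0 j else 1 - \sum_j u 0 j),
  (fun i => if unlift ord0 i is Some j then row j M else 0); split.
- move=> i; case: (unlift ord0 i) => [j|].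
    by exists (x + row j M) => //; rewrite addrC addKr.
  by exists x => //; rewrite subrr.
- rewrite big_ord_recl unlift_none.
  rewrite -[RHS](subrK (\sum_j u 0 j)); congr (_ + _).
  by apply: eq_bigr => i _; rewrite liftK.
- rewrite big_ord_recl unlift_none scaler0 add0r mulmx_sum_row.
  by apply: eq_bigr => i _; rewrite liftK.
Qed.

(** The point is the barycenter of a base point and of finitely many points whose differences from
    it span the parallel subspace: its weights are all positive, so small changes of them remain
    admissible. *)
Lemma exists_relative_interior {C} :
  @convex_set R 'rV[R]_n C -> C !=set0 ->
  exists c (rho : R), [/\ C c, 0 < rho &
    forall w, parallel_subspace C w -> `|w| < rho -> C (c + w)].
Proof.
move=> Ccvx [x Cx].
have [m [M [CM spanM]]] := exists_spanning_differences Cx.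
rewrite (parallel_subspaceE Cx CM spanM).
(* The base point and the [m] other points share the weight equally. *)
pose e : R := m.+1%:R^-1.
have e0 : 0 < e by rewrite invr_gt0 ltr0n.
have e1 : e <= 1 by rewrite invf_le1 ?ltr0n// ler1n.
have me : m%:R * e + e = 1.
  by rewrite -{2}[e]mul1r -mulrDl natr1 divff// pnatr_eq0.
(* [B] dominates the absolute column sums of [pinvmx M], so a vector of norm below [rho] has
   coordinates at most [rho * B = e ^+ 2]. The leading 1 makes [B] positive. *)
pose B : R := 1 + \sum_i \sum_j `|pinvmx M j i|.
have B0 : 0 < B by rewrite ltr_pwDl// !sumr_ge0// => i _; rewrite sumr_ge0.
pose rho := e ^+ 2 / B.
have rho0 : 0 < rho by rewrite divr_gt0// exprn_gt0.
have inC (u : 'rV[R]_m) : (forall i, `|u 0 i| <= e ^+ 2) ->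
    C (x + \sum_i e *: row i M + u *m M).
  move=> ub.
  have -> : x + \sum_i e *: row i M + u *m M =
      x + \sum_i (e + u 0 i) *: ((x + row i M) - x).
    rewrite mulmx_sum_row -addrA -big_split/=; congr (_ + _).
    by apply: eq_bigr => i _; rewrite scalerDl [x + _]addrC addrK.
  apply: convex_subcombination => // [i|].
    have /ler_normlP[] := ub i; rewrite expr2.
    have : e * e <= e by rewrite ler_piMr// ltW.
    lra.
  (* The total is [m * e + (m * e) * e], and [m * e <= 1] bounds it by [m * e + e = 1]. *)
  apply: (@le_trans _ _ (\sum_(i < m) (e + e ^+ 2))).
    by apply: ler_sum => i _; rewrite lerD2l (le_trans (ler_norm _)).
  rewrite sumr_const card_ord -mulr_natl expr2 mulrDr mulrA -[leRHS]me lerD2l.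
  by rewrite ler_piMl// ?(ltW e0)// -[leRHS]me lerDl ltW.
exists (x + \sum_i e *: row i M), rho; split => //.
  have := inC 0; rewrite mul0mx addr0; apply => i.
  by rewrite mxE normr0 exprn_ge0// ltW.
move=> w /= wM wrho.
rewrite -(mulmxKpV wM); apply: inC => i.
rewrite mxE (le_trans (ler_norm_sum _ _ _))//.
apply: (@le_trans _ _ (\sum_j rho * `|pinvmx M j i|)).
  apply: ler_sum => j _; rewrite normrM ler_wpM2r//.
  by rewrite (le_trans (ler_norm_coord _ _))// ltW.
rewrite -mulr_sumr -[leRHS](divfK (lt0r_neq0 B0)) ler_wpM2l ?(ltW rho0)//.
rewrite /B (bigD1 i)//= addrCA lerDl addr_ge0// sumr_ge0// => k _.
by rewrite sumr_ge0.
Qed.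

Lemma parallel_subspaceP {C} : C !=set0 ->
  [/\ forall c c', C c -> C c' -> parallel_subspace C (c - c'),
      forall (a : R) w, parallel_subspace C w -> parallel_subspace C (a *: w) &
      forall w w', parallel_subspace C w -> parallel_subspace C w' ->
        parallel_subspace C (w + w')].
Proof.
move=> [x Cx]; have [m [M [CM spanM]]] := exists_spanning_differences Cx.
rewrite (parallel_subspaceE Cx CM spanM); split.
- move=> c c' Cc Cc' /=; rewrite (_ : c - c' = (c - x) - (c' - x)); last first.
    by rewrite opprB addrA subrK.
  by apply: addmx_sub; [exact: spanM|rewrite eqmx_opp; exact: spanM].
- by move=> a w; exact: scalemx_sub.
- by move=> w w'; exact: addmx_sub.
Qed.
End RelativeInterior.

(** * Accepted steps near a point that is not d-stationary *)

Section Descent.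
Context {R : realType} {n : nat}.
Implicit Types (C : set 'rV[R]_n) (h : 'rV[R]_n -> R).

Lemma locally_lipschitz_ball h (x : 'rV[R]_n) :
  [locally [lipschitz h u | u in [set: 'rV[R]_n]]] ->
  exists K delta : R, [/\ 0 < K, 0 < delta &
    forall u w, `|x - u| < delta -> `|x - w| < delta ->
      `|h u - h w| <= K * `|u - w|].
Proof.
move=> /(_ (x, x) (conj I I)).
move=> /pinfty_ex_gt0[K K0 /nbhs_ballP[e /= e0 eK]].
exists K, e; split => // u w xu xw.
by apply: (eK (u, w)) => //; split; rewrite -ball_normE.
Qed.

Lemma locally_lipschitz_continuous h :
  [locally [lipschitz h u | u in [set: 'rV[R]_n]]] -> continuous h.
Proof.
move=> /locally_lipschitz_ball hL x.
have [K [e [K0 e0 eK]]] := hL x.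
apply/(@cvgrPdist_lt _ _ _ (nbhs x) (@nbhs_filter _ x)) => eps eps0.
apply/nbhs_ballP.
exists (Num.min e (eps / K)); first by rewrite /= lt_min e0 divr_gt0.
move=> u; rewrite -ball_normE/= lt_min => /andP[xu xue].
have xx : `|x - x| < e by rewrite subrr normr0.
by rewrite (le_lt_trans (eK _ _ xx xu))// mulrC -ltr_pdivlMr.
Qed.

Lemma near_right_mulr_lt (a b : R) : 0 < b -> \forall s \near 0^'+, s * a < b.
Proof.
move=> b0; have a0 : 0 < `|a| + 1 by rewrite ltr_wpDl.
near=> s; have s0 : 0 < s by [].
apply: (@le_lt_trans _ _ (s * (`|a| + 1))).
  by rewrite ler_pM2l// (le_trans (ler_norm _))// lerDl.
rewrite -ltr_pdivlMr//; near: s; apply: nbhs_right_lt; exact: divr_gt0.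
Unshelve. all: by end_near. Qed.

Lemma enorm_eq0 (u : 'rV[R]_n) : enorm u = 0 -> u = 0.
Proof.
move=> /eqP; rewrite sqrtr_eq0 => u0.
have s0 : \sum_(i < n) u ord0 i ^+ 2 = 0.
  by apply/eqP; rewrite eq_le u0 sumr_ge0// => i _; exact: sqr_ge0.
apply/rowP => i; rewrite mxE; apply/eqP; rewrite -sqrf_eq0; apply/eqP.
by apply: (psumr_eq0P _ s0) => // j _; exact: sqr_ge0.
Qed.

Lemma enormZ (a : R) (u : 'rV[R]_n) : 0 <= a -> enorm (a *: u) = a * enorm u.
Proof.
move=> a0; rewrite /enorm -{2}[a]ger0_norm// -sqrtr_sqr -sqrtrM ?sqr_ge0//.
by rewrite mulr_sumr; congr Num.sqrt; apply: eq_bigr => i _; rewrite mxE exprMn.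
Qed.

(** Difference quotients eventually stay below half the negative derivative; [c] is the absolute
    value of that half. *)
Lemma has_dir_deriv_descent h x w :
  has_dir_deriv h x w -> dir_deriv h x w < 0 ->
  exists c delta : R, [/\ 0 < c, 0 < delta &
    forall s, 0 < s -> s < delta -> h (x + s *: w) < h x - c * s].
Proof.
move=> hd h0.
have lt2 : dir_deriv h x w < dir_deriv h x w / 2 by lra.
have [e /= e0 He] :
    \forall s \near 0^'+, diff_quotient h x w s < dir_deriv h x w / 2.
  exact: cvgr_lt hd _ lt2.
exists (- dir_deriv h x w / 2), e; split => //.
  by rewrite divr_gt0 ?oppr_gt0.
move=> s s0 se; have : diff_quotient h x w s < dir_deriv h x w / 2.
  by apply: He => //=; rewrite sub0r normrN gtr0_norm.
rewrite /diff_quotient ltr_pdivrMr//; lra.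
Qed.

(* Moving the descent direction slightly towards a relative interior point
   keeps it a descent direction and leaves room inside [C] around the trial
   point. *)
Lemma exists_robust_descent_step C h x d (gamma r : R) :
  @convex_set R 'rV[R]_n C ->
  [locally [lipschitz h u | u in [set: 'rV[R]_n]]] ->
  has_dir_deriv h x d -> 0 < r -> C x ->
  feasible_directions C x d -> dir_deriv h x d < 0 ->
  exists v t rho, [/\ sphere_in (parallel_subspace C) v, 0 < t < r, 0 < rho,
    (forall w, parallel_subspace C w -> `|w| < rho -> C (x + t *: v + w)) &
    h (x + t *: v) + gamma / 2 * t ^+ 2 < h x].
Proof.
move=> Ccvx hL hd r0 Cx [l l0 Cl] d0.
have Cne : C !=set0 by exists x.
have [LB LZ LD] := @parallel_subspaceP _ _ C Cne.
have [cs [rho [Ccs rho0 Crho]]] := exists_relative_interior Ccvx Cne.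
have [c [del' [c0 del'0 hdesc]]] := has_dir_deriv_descent h x d hd d0.
have [K [del [K0 del0 Kdel]]] := locally_lipschitz_ball h x hL.
pose w1 := l *: d; pose W := `|cs - (x + w1)|.
have KW0 : 0 <= K * W by rewrite mulr_ge0 ?normr_ge0// ltW.
have c10 : 0 < c * l by rewrite mulr_gt0.
(* Tilting costs at most [K * (e * W)] per unit of [s]; this [e] keeps the cost within half of the
   gain [c * l]. *)
pose e := c * l / (2 * (K * W + c * l)).
have D0 : 0 < 2 * (K * W + c * l) by rewrite mulr_gt0// ltr_wpDl.
have e0 : 0 < e by rewrite divr_gt0.
have e1 : e < 1 by rewrite ltr_pdivrMr//; lra.
have eKW : e * (K * W) <= c * l / 2.
  rewrite /e [_ / _ * _]mulrAC ler_pdivrMr//.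
  have : 0 <= (c * l) * (c * l) by rewrite mulr_ge0 ?ltW.
  lra.
clearbody e; pose de := w1 + e *: (cs - (x + w1)).
(* [x + de + w] lies at fraction [e] of the segment from [x + l *: d] to [cs + e^-1 *: w]. *)
have Cde w : parallel_subspace C w -> `|w| < e * rho -> C (x + de + w).
  move=> Lw we.
  have Cw : C (cs + e^-1 *: w).
    apply: Crho; first exact: LZ.
    by rewrite normrZ gtr0_norm ?invr_gt0// ltr_pdivrMl.
  have := convex_setP e Ccvx Cl Cw.
  rewrite (ltW e0) (ltW e1) => /(_ isT); congr C.
  apply/rowP => i; rewrite !mxE; field; exact: lt0r_neq0.
have Lde : parallel_subspace C de.
  have -> : de = x + de - x by rewrite addrC addKr.
  apply: (LB _ x) => //; rewrite -[_ + _]addr0; apply: Cde.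
    by rewrite -(subrr x); exact: LB.
  by rewrite normr0 mulr_gt0.
(* Only a fraction [s] of [de] is travelled; all remaining requirements hold for small [s]. *)
near (0 : R)^'+ => s.
have s0 : 0 < s by [].
have s1 : s < 1 by near: s; apply: nbhs_right_lt.
have sw1 : s * `|w1| < del by near: s; exact: near_right_mulr_lt.
have sde : s * `|de| < del by near: s; exact: near_right_mulr_lt.
have hs : h (x + s *: w1) < h x - c * l * s.
  rewrite /w1 scalerA -mulrA [l * s]mulrC; apply: hdesc; first exact: mulr_gt0.
  by near: s; exact: near_right_mulr_lt.
have hde : h (x + s *: de) < h x - c * l / 2 * s.
  have dist : `|(x + s *: de) - (x + s *: w1)| = s * (e * W).
    rewrite opprD addrACA subrr add0r -scalerBr /de (addrC w1) addrK.
    by rewrite scalerA normrZ gtr0_norm ?mulr_gt0// -mulrA.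
  have /ler_normlP[_] : `|h (x + s *: de) - h (x + s *: w1)| <=
      K * (s * (e * W)).
    rewrite -dist; apply: Kdel.
    - by rewrite opprD addrA subrr sub0r normrN normrZ gtr0_norm.
    - by rewrite opprD addrA subrr sub0r normrN normrZ gtr0_norm.
  have : s * (e * (K * W)) <= s * (c * l / 2) by rewrite ler_pM2l.
  lra.
(* [h] drops strictly along [de], so [de] is not 0 and can be normalized. *)
have E0 : 0 < enorm de.
  rewrite lt_neqAle sqrtr_ge0 andbT eq_sym; apply/eqP => /enorm_eq0 de0.
  move: hde; rewrite de0 scaler0 addr0.
  have : 0 < c * l * s by rewrite mulr_gt0.
  lra.
have slam : s * enorm de < r.
  by near: s; exact: near_right_mulr_lt.
have sg : s * (gamma / 2 * enorm de ^+ 2) < c * l / 2.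
  near: s; apply: near_right_mulr_lt; exact: divr_gt0.
(* The trial point is [x + s *: de]; contraction towards [x] by the factor [s] scales the room
   [e * rho] accordingly. *)
exists ((enorm de)^-1 *: de), (s * enorm de), (s * (e * rho)).
rewrite scalerA mulfK ?gt_eqF//; split.
- split; first exact: LZ.
  by rewrite enormZ ?invr_ge0 ?ltW// mulVf// gt_eqF.
- by rewrite mulr_gt0.
- by rewrite !mulr_gt0.
- move=> w Lw ws.
  have Cw : C (x + de + s^-1 *: w).
    apply: Cde; first exact: LZ.
    by rewrite normrZ gtr0_norm ?invr_gt0// ltr_pdivrMl.
  have := convex_setP s Ccvx Cx Cw.
  rewrite (ltW s0) (ltW s1) => /(_ isT); congr C.
  apply/rowP => i; rewrite !mxE; field; exact: lt0r_neq0.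
- have : s * (s * (gamma / 2 * enorm de ^+ 2)) < s * (c * l / 2).
    by rewrite ltr_pM2l.
  rewrite exprMn; lra.
Unshelve. all: by end_near. Qed.

(* The conditions met by the robust step are open relative to [C], so the step
   survives a perturbation of base point, direction and step length. *)
Lemma exists_descent_neighborhoods C h x d (gamma r : R) :
  @convex_set R 'rV[R]_n C ->
  [locally [lipschitz h u | u in [set: 'rV[R]_n]]] ->
  has_dir_deriv h x d -> 0 < r -> C x ->
  feasible_directions C x d -> dir_deriv h x d < 0 ->
  exists v t, exists (U V : set 'rV[R]_n) (T : set R),
    [/\ sphere_in (parallel_subspace C) v /\ 0 < t < r,
      nbhs x U, nbhs v V, nbhs t T &
      forall x' v' t', U x' -> V v' -> T t' -> C x' ->
        parallel_subspace C v' ->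
        C (x' + t' *: v') /\
        h (x' + t' *: v') + gamma / 2 * t' ^+ 2 < h x'].
Proof.
move=> Ccvx hL hd r0 Cx dx d0.
have [LB LZ LD] := @parallel_subspaceP _ _ C (ex_intro _ x Cx).
have [v [t [rho [Sv tr rho0 Crho ht]]]] :=
  exists_robust_descent_step C h x d gamma r Ccvx hL hd r0 Cx dx d0.
have hc := locally_lipschitz_continuous h hL.
(* The trial point is continuous in base point, direction and length jointly, so sufficient decrease
   and closeness to the robust trial point hold on a product neighborhood. *)
pose step (p : 'rV[R]_n * 'rV[R]_n * R) : 'rV[R]_n := p.1.1 + p.2 *: p.1.2.
have cx : (fun p : 'rV[R]_n * 'rV[R]_n * R => p.1.1) @ (x, v, t) --> x.
  apply: (cvg_comp fst fst cvg_fst cvg_fst).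
have cv : (fun p : 'rV[R]_n * 'rV[R]_n * R => p.1.2) @ (x, v, t) --> v.
  apply: (cvg_comp fst snd cvg_fst cvg_snd).
have ct : (fun p : 'rV[R]_n * 'rV[R]_n * R => p.2) @ (x, v, t) --> t.
  exact: cvg_snd.
have cs : step @ (x, v, t) --> x + t *: v by apply: cvgD cx (cvgZ ct cv).
have cF : (fun p => h (step p) + gamma / 2 * (p.2 * p.2) - h p.1.1) @ (x, v, t)
    --> h (x + t *: v) + gamma / 2 * (t * t) - h x.
  apply: cvgB; last exact: (cvg_comp _ _ cx (hc x)).
  apply: cvgD; first exact: (cvg_comp _ _ cs (hc _)).
  by apply: cvgMr; apply: cvgM.
have F0 : h (x + t *: v) + gamma / 2 * (t * t) - h x < 0.
  by rewrite subr_lt0 -expr2.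
have near1 : \forall p \near (x, v, t),
    h (step p) + gamma / 2 * (p.2 * p.2) - h p.1.1 < 0.
  exact: (cvgr_lt _ cF _ F0).
have near2 : \forall p \near (x, v, t), `|(x + t *: v) - step p| < rho.
  exact: (@cvgrPdist_lt _ _ _ (nbhs (x, v, t)) (@nbhs_filter _ (x, v, t)) _ _).1
    cs _ rho0.
have [[A T] [/= [[U V] [/= xU vV] UVA] tT] AT] := filterI near1 near2.
exists v, t, U, V, T; split => //.
move=> x' v' t' Ux Vv Tt Cx' Lv'.
have [/= Fl dl] := AT (x', v', t') (conj (UVA (x', v') (conj Ux Vv)) Tt).
split; last by rewrite expr2 -subr_lt0.
(* Both base points are in [C] and both directions are parallel to it, so the displacement from the
   robust trial point stays in the parallel subspace. *)
rewrite (_ : x' + t' *: v' =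
    (x + t *: v) + ((x' - x) + (t' *: v' + - t *: v))); last first.
  by apply/rowP => i; rewrite !mxE; ring.
apply: Crho.
  by apply: (LD) (LB _ _ Cx' Cx) (LD _ _ (LZ _ _ Lv') (LZ _ _ Sv.1)).
rewrite distrC in dl; apply: le_lt_trans dl.
by rewrite /step/= scaleNr opprD addrACA.
Qed.
End Descent.

(** * A countable base of balls, and the support of a measure *)

Section RationalBalls.
Context {R : realType} {n : nat}.

(** A nonpositive radius is allowed and gives the empty set. *)
Definition rational_ball (q : 'rV[rat]_n * rat) : set 'rV[R]_n :=
  ball (map_mx ratr q.1 : 'rV[R]_n) (ratr q.2).

Lemma nbhs_rational_ball (x : 'rV[R]_n) (U : set 'rV[R]_n) : nbhs x U ->
  exists2 q, rational_ball q x & rational_ball q `<=` U.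
Proof.
move=> /nbhs_ballP[e /= e0 eU].
(* With center within [c] of [x] and radius [c < e / 2], every point of the ball is within [e] of
   [x]. *)
have [c ce] := @rat_in_itvoo R 0 (e / 2) ltac:(by rewrite divr_gt0).
move: ce; rewrite in_itv/= => /andP[c0 ce].
have xc (j : 'I_n) : exists q : rat, `|ratr q - x ord0 j| < ratr c.
  have [|q] := @rat_in_itvoo R (x ord0 j - ratr c) (x ord0 j + ratr c).
    by rewrite ltrBlDr -addrA ltrDl addr_gt0.
  by rewrite in_itv/= => qx; exists q; rewrite ltr_distl.
have [q qx] := choice xc.
have qxc : rational_ball (\row_j q j, c) x.
  by split => // i j; rewrite !mxE (ord1 i); exact: qx.
exists (\row_j q j, c) => // y cy; apply: eU.
apply: (@le_ball _ _ x (ratr c + ratr c)); first by rewrite /=; lra.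
exact: ball_triangle (ball_sym qxc) cy.
Qed.

Lemma open_rational_ball (q : 'rV[rat]_n * rat) : open (rational_ball q).
Proof.
rewrite /rational_ball; case: q => q e /=.
have [e0|e0] := ltP 0 (ratr e : R); first exact: ball_open.
rewrite (_ : ball _ _ = set0); first exact: open0.
by apply/seteqP; split => // y [] /=; rewrite ltNge e0.
Qed.

Lemma measurable_rational_ball (q : 'rV[rat]_n * rat) :
  measurable (rational_ball q : set (borel_rV R n)).
Proof. by apply: sub_sigma_algebra; exact: open_rational_ball. Qed.

(** A point outside the support has a null open neighborhood, hence lies in a null rational ball;
    there are only countably many of these. *)
Lemma negligible_setC_measure_support (mu : probability (borel_rV R n) R) :
  mu.-negligible (~` measure_support (mu : set 'rV[R]_n -> \bar R)).
Proof.
pose F k : set (borel_rV R n) :=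
  if @unpickle ('rV[rat]_n * rat)%type k is Some q then
    if mu (rational_ball q) == 0%E then rational_ball q else set0
  else set0.
have F0 k : mu.-negligible (F k).
  rewrite /F; case: unpickle => [q|]; last exact: negligible_set0.
  case: eqP => q0; last exact: negligible_set0.
  by exists (rational_ball q); split => //; exact: measurable_rational_ball.
apply: negligibleS (negligible_bigcup F0) => x /=.
rewrite /measure_support /= => /existsNP[U] /not_implyP[oU] /not_implyP[Ux].
move=> /negP; rewrite -leNgt => U0.
have [q qx qU] := nbhs_rational_ball _ _ (open_nbhs_nbhs (conj oU Ux)).
exists (pickle q) => //; rewrite /F pickleK.
suff -> : mu (rational_ball q) = 0%E by rewrite eqxx.
apply/eqP; rewrite eq_le measure_ge0 andbT; apply: le_trans U0.
apply: le_measure => //; rewrite inE.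
  exact: measurable_rational_ball.
exact: sub_sigma_algebra.
Qed.
End RationalBalls.

(** * Repeated trials with a fixed probability of success *)

Section RepeatedTrials.
Context {d : measure_display} {Omega : measurableType d} {R : realType}.
Variable P : probability Omega R.
Implicit Types (A B : nat -> set Omega).

(** [A j] stands for an attempt at time [j], [B j] for a draw that makes it succeed. *)
Definition no_success A B (k : nat) : set Omega :=
  \bigcap_(j in `I_k) ~` (A j `&` B j).

Lemma measurable_no_success A B k :
  (forall k, measurable (A k)) -> (forall k, measurable (B k)) ->
  measurable (no_success A B k).
Proof.
move=> mA mB; apply: bigcap_measurableType => j _.
by apply: measurableC; exact: measurableI.
Qed.

(* The events of a first success at time [k] are disjoint, so the attempts
   made before the first success have summable probabilities, and
   Borel-Cantelli applies to them. *)
Lemma ae_success A B (p : R) :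
  (forall k, measurable (A k)) -> (forall k, measurable (B k)) -> 0 < p ->
  (forall k, P (B k `&` (A k `&` no_success A B k)) =
             p%:E * P (A k `&` no_success A B k))%E ->
  {ae P, forall w, (forall K, exists2 k, (K <= k)%N & A k w) ->
    exists k, A k w /\ B k w}.
Proof.
move=> mA mB p0 ind.
pose F k := A k `&` no_success A B k.
have mF k : measurable (F k).
  by apply: measurableI => //; exact: measurable_no_success.
have mBF k : measurable (B k `&` F k) by exact: measurableI.
have tBF : trivIset setT (fun k => B k `&` F k).
  apply/trivIsetP => i j _ _; wlog ij : i j / (i < j)%N.
    move=> W; rewrite neq_ltn => /orP[] ij.
      by apply: W => //; rewrite ltn_eqF.
    by rewrite setIC; apply: W => //; rewrite ltn_eqF.
  move=> _; apply/seteqP; split => // w [[Bi [Ai _]] [_ [_ /(_ i ij)]]].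
  by apply.
have sumF : (\sum_(0 <= k <oo) P (F k) < +oo)%E.
  (* Otherwise the disjoint events of a first success would have total probability [p] times
     infinity. *)
  rewrite ltey; apply/eqP => Foo.
  have : (P (\bigcup_k (B k `&` F k)) <= 1)%E.
    by apply: probability_le1; exact: bigcupT_measurable.
  rewrite measure_bigcup//.
  rewrite (eq_eseriesr (g := fun k => p%:E * P (F k))%E) => [|k _]; last first.
    exact: ind.
  rewrite nneseriesZl; last by move=> *; exact: measure_ge0.
  rewrite (eq_eseriesl _ (Q := xpredT)) => [|k]; last by rewrite in_setT.
  by rewrite Foo gt0_muley.
(* An outcome with infinitely many attempts and no success lies in [F k] at each attempt [k], hence
   in this null set. *)
exists (lim_sup_set F); split.
- by apply: bigcapT_measurable => k; apply: bigcup_measurable.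
- exact: lim_sup_set_cvg0.
- move=> w /not_implyP[Aio /forallNP noS] K _.
  have [k Kk Ak] := Aio K; exists k => //; split => // j _.
  exact: noS.
Qed.

(** The trials are restarted at each time [K]: infinitely many attempts remain, and countably many
    restarts cost only a null set. *)
Lemma ae_infinitely_many_successes A B (p : R) :
  (forall k, measurable (A k)) -> (forall k, measurable (B k)) -> 0 < p ->
  (forall K k, P (B (K + k)%N `&` (A (K + k)%N `&`
       no_success (fun j => A (K + j)%N) (fun j => B (K + j)%N) k)) =
     p%:E * P (A (K + k)%N `&`
       no_success (fun j => A (K + j)%N) (fun j => B (K + j)%N) k))%E ->
  {ae P, forall w, (forall K, exists2 k, (K <= k)%N & A k w) ->
    forall K, exists2 k, (K <= k)%N & A k w /\ B k w}.
Proof.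
move=> mA mB p0 ind.
have := @ae_foralln _ _ _ P (fun K w =>
  (forall L, exists2 k, (L <= k)%N & A (K + k)%N w) ->
  exists k, A (K + k)%N w /\ B (K + k)%N w)
  (fun K => ae_success _ _ _ (fun k => mA (K + k)%N) (fun k => mB (K + k)%N)
     p0 (ind K)).
apply: filterS => w H Aio K.
have [L|k ABk] := H K.
  have [k Lk Ak] := Aio (K + L)%N; exists (k - K)%N.
    by rewrite leq_subRL ?(leq_trans _ Lk) ?leq_addr.
  by rewrite subnKC// (leq_trans _ Lk)// leq_addr.
by exists (K + k)%N => //; rewrite leq_addr.
Qed.
End RepeatedTrials.

(** * Generated sigma-algebras and countable families of almost sure properties *)

Section SigmaAlgebras.
Context {T : pointedType}.
Variable G : set_system T.

Lemma sigma_algebraI (A B : set T) :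
  <<s G >> A -> <<s G >> B -> <<s G >> (A `&` B).
Proof. exact: (@measurableI _ (g_sigma_algebraType G)). Qed.

Lemma sigma_algebra_bigcap (D : set nat) (A : (set T)^nat) :
  (forall i, D i -> <<s G >> (A i)) -> <<s G >> (\bigcap_(i in D) A i).
Proof. exact: (@bigcap_measurableType _ (g_sigma_algebraType G)). Qed.
End SigmaAlgebras.

Lemma ae_forall_countable {d : measure_display} {Omega : measurableType d}
    {R : realType} (P : probability Omega R) (I : countType)
    (Q : I -> Omega -> Prop) :
  (forall i, {ae P, forall w, Q i w}) -> {ae P, forall w, forall i, Q i w}.
Proof.
move=> Qae.
have /ae_foralln : forall k, {ae P, forall w,
    if unpickle k is Some i then Q i w else True}.
  by move=> k; case: unpickle => [i|]; [exact: Qae|exact: aeW].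
apply: filterS => w Qw i.
by have := Qw (pickle i); rewrite pickleK.
Qed.

(** * Consequences of the sampling assumptions *)

Section Sampling.
Context {d : measure_display} {Omega : measurableType d} {R : realType}
  {n : nat}.
Variables (P : probability Omega R) (C : set 'rV[R]_n) (r : R).
Variables (Dv : probability (borel_rV R n) R)
  (Dt : probability (measurableTypeR R) R).
Variables (x v : nat -> Omega -> 'rV[R]_n) (that : nat -> Omega -> R).
Hypothesis x_measurable : forall k, random_vector (x k).
Hypothesis sampling : sampling_assumptions P C r Dv Dt x v that.

(** A visit to [U] is an attempt and a sample in the product of [V] and [T] a success. The past
    decides on the attempt and on earlier failures, and the sample is independent of it. *)
Lemma ae_sampled_infinitely_often (U V : set (borel_rV R n))
    (T : set (measurableTypeR R)) :
  measurable U -> measurable V -> measurable T ->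
  (0 < Dv V)%E -> (0 < Dt T)%E ->
  {ae P, forall w, (forall K, exists2 k, (K <= k)%N & U (x k w)) ->
    forall K, exists2 k, (K <= k)%N &
      U (x k w) /\ V (v k w) /\ T (that k w)}.
Proof.
move=> mU mV mT V0 T0.
pose A k := x k @^-1` U; pose B k := v k @^-1` V `&` that k @^-1` T.
have mA k : measurable (A k).
  by have := x_measurable k measurableT _ mU; rewrite setTI.
have mB k : measurable (B k).
  apply: measurableI.
    by have := v_measurable sampling k measurableT mV; rewrite setTI.
  by have := that_measurable sampling k measurableT mT; rewrite setTI.
have PB k : P (B k) = (fine (Dv V) * fine (Dt T))%:E.
  have -> : P (B k) = (P (v k @^-1` V) * P (that k @^-1` T))%E.
    by apply: (v_that_independent sampling); [exists V|exists T];
      rewrite ?setTI.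
  rewrite (v_law sampling)// (that_law sampling)// EFinM.
  by rewrite !fineK ?fin_num_measure.
apply: (ae_infinitely_many_successes P A B (fine (Dv V) * fine (Dt T))) => //.
  rewrite mulr_gt0// fine_gt0// ?V0 ?T0.
    by rewrite (le_lt_trans (probability_le1 _ _)) ?ltry.
  by rewrite (le_lt_trans (probability_le1 _ _)) ?ltry.
(* Reading [p] as the probability of [B (K + k)] turns the goal into the product rule. *)
move=> K k; rewrite -(PB (K + k)%N).
apply: (pair_past_independent sampling).
  by exists (V `*` T); [exact: measurableX|rewrite setTI].
apply: sigma_algebraI.
  apply: sub_sigma_algebra; left; exists (K + k)%N => //=.
  by exists U => //; rewrite setTI.
(* Earlier failures involve iterates and samples at indices [K + j < K + k] only. *)
apply: sigma_algebra_bigcap => j /= jk; apply: sigma_algebraC.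
have Kjk : (K + j < K + k)%N by rewrite ltn_add2l.
apply: sigma_algebraI; last apply: sigma_algebraI.
- apply: sub_sigma_algebra; left; exists (K + j)%N; first exact: ltnW.
  by exists U => //; rewrite setTI.
- apply: sub_sigma_algebra; right; exists (K + j)%N => //; left.
  by exists V => //; rewrite setTI.
- apply: sub_sigma_algebra; right; exists (K + j)%N => //; right.
  by exists T => //; rewrite setTI.
Qed.

Lemma ae_sphere_in :
  {ae P, forall w, forall k, sphere_in (parallel_subspace C) (v k w)}.
Proof.
apply: ae_foralln => k.
have [N [mN N0 supN]] := negligible_setC_measure_support Dv.
exists (v k @^-1` N); split.
- by have := v_measurable sampling k measurableT mN; rewrite setTI.
- by rewrite -[RHS]N0; exact: (v_law sampling).
- move=> w /= vw; apply: supN; rewrite /= => H; apply: vw.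
  by rewrite -(Dv_support sampling).
Qed.
End Sampling.

(** * Deterministic properties of a run: feasibility, decrease, summable squared steps *)

Section Run.
Context {d : measure_display} {Omega : measurableType d} {R : realType}
  {n : nat}.
Variables (C : set 'rV[R]_n) (h : 'rV[R]_n -> R) (gamma : R).
Variables (oracle : nat -> Omega -> 'rV[R]_n -> 'rV[R]_n).
Variables (x y z v : nat -> Omega -> 'rV[R]_n) (that tex : nat -> Omega -> R).
Hypothesis gamma_gt0 : 0 < gamma.
Hypothesis oracle_feasible : forall k w u, C u -> C (oracle k w u).
Hypothesis x_run : augmented_run C h gamma oracle x y z v that tex.

(** An accepted trial satisfies this by the acceptance test; otherwise the step is 0 and [y k.+1]
    equals [x k]. *)
Lemma run_step k w : C (x k w) ->
  C (y k.+1 w) /\ h (y k.+1 w) + gamma / 2 * tex k w ^+ 2 <= h (x k w).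
Proof.
move=> Cx; rewrite (run_y x_run) (run_tex x_run).
case: asboolP => _; first by rewrite scale0r addr0 expr0n mulr0 addr0.
case: asboolP => [[Cxt /ltW]//|_].
by rewrite scale0r addr0 expr0n mulr0 addr0.
Qed.

Lemma run_feasible k w : C (x k w).
Proof.
elim: k => [|k IH]; first exact: (run_init x_run).
have [[->|->] _] := run_x x_run k w; first exact: (run_step _ _ IH).1.
by rewrite (run_z x_run); exact: oracle_feasible.
Qed.

Lemma run_decrease k w :
  h (x k.+1 w) + gamma / 2 * tex k w ^+ 2 <= h (x k w).
Proof.
have [_ ystep] := run_step _ _ (run_feasible k w).
(* The oracle can only help: [x k.+1] is at least as good as [y k.+1]. *)
apply: le_trans ystep; rewrite lerD2r.
by apply: (run_x x_run k w).2; left.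
Qed.

Lemma run_cluster w xbar : closed C -> cluster (x k w @[k --> \oo]) xbar ->
  C xbar.
Proof.
move=> Ccl xcl; apply: Ccl => B nB.
apply: (xcl C B _ nB); exists 0%N => // k _; exact: run_feasible.
Qed.

Hypothesis h_bounded_below : has_lbound (h @` C).

Lemma run_series_bounded w : exists M, forall k,
  series (fun j => tex j w ^+ 2) k <= M.
Proof.
have [b hb] := h_bounded_below.
exists ((h (x 0%N w) - b) / (gamma / 2)) => k.
rewrite ler_pdivlMr ?divr_gt0// mulrC.
have hk : b <= h (x k w) by apply: hb; exists (x k w) => //; exact: run_feasible.
suff : gamma / 2 * series (fun j => tex j w ^+ 2) k <= h (x 0%N w) - h (x k w).
  by move/le_trans; apply; rewrite lerD2l lerN2.
elim: k {hk} => [|k IH]; first by rewrite /series/= big_geq// mulr0 subrr.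
have := run_decrease k w; rewrite /series/= in IH *.
rewrite big_nat_recr//= mulrDr; lra.
Qed.

Lemma run_nneseries_lty w : (\sum_(0 <= k <oo) ((tex k w) ^+ 2)%:E < +oo)%E.
Proof.
have [M hM] := run_series_bounded w.
apply: (@le_lt_trans _ _ M%:E); last exact: ltry.
apply: lime_le.
  by apply: is_cvg_nneseries => k _ _; rewrite lee_fin sqr_ge0.
by apply: nearW => k; rewrite sumEFin lee_fin; exact: hM.
Qed.

Lemma run_tex_cvg0 w : tex k w @[k --> \oo] --> (0 : R).
Proof.
have [M hM] := run_series_bounded w.
have cs : cvgn (series (fun j => tex j w ^+ 2)).
  apply: nondecreasing_is_cvgn; last by exists M => _ [k _ <-]; exact: hM.
  apply/nondecreasing_seqP => k; rewrite /series/= big_nat_recr//= lerDl.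
  exact: sqr_ge0.
have sq0 := cvg_series_cvg_0 cs.
apply/cvgrPdist_lt => e e0.
have e20 : 0 < e ^+ 2 by rewrite exprn_gt0.
near=> k.
have : tex k w ^+ 2 < e ^+ 2 by near: k; exact: cvgr_lt sq0 _ e20.
rewrite sub0r normrN -(real_normK (num_real (tex k w))).
by rewrite ltr_pXn2r ?nnegrE// ltW.
Unshelve. all: by end_near. Qed.
End Run.

(** * Summability of the steps and d-stationarity of accumulation points *)

Lemma d_stationary_singleton {R : realType} {n : nat} (a : 'rV[R]_n) h :
  d_stationary [set a] h a.
Proof.
(* The only feasible direction is 0, along which all difference quotients vanish. *)
split => // w [l l0 /= /eqP]; rewrite -subr_eq0 addrC addKr scaler_eq0 gt_eqF//=.
move=> /eqP ->.
suff -> : dir_deriv h a 0 = 0 by [].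
rewrite /dir_deriv (_ : diff_quotient h a 0 = cst 0); first exact: lim_cst.
by apply/funext => t; rewrite /diff_quotient scaler0 addr0 subrr mul0r.
Qed.

Theorem theorem4p1 (R : realType) (n : nat)
  (d : measure_display) (Omega : measurableType d) (P : probability Omega R)
  (C : set 'rV[R]_n) (h : 'rV[R]_n -> R) (gamma r : R)
  (oracle : nat -> Omega -> 'rV[R]_n -> 'rV[R]_n)
  (Dv : probability (borel_rV R n) R) (Dt : probability (measurableTypeR R) R)
  (x y z v : nat -> Omega -> 'rV[R]_n) (that tex : nat -> Omega -> R)
  (C_nonempty : C !=set0) (C_closed : closed C)
  (C_convex : @convex_set R 'rV[R]_n C)
  (h_loc_lip : [locally [lipschitz h u | u in [set: 'rV[R]_n]]])
  (h_bounded_below : has_lbound (h @` C))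
  (h_dir_deriv : forall u w, C u -> has_dir_deriv h u w)
  (gamma_gt0 : 0 < gamma) (r_gt0 : 0 < r)
  (oracle_feasible : forall k omega u, C u -> C (oracle k omega u))
  (x_run : augmented_run C h gamma oracle x y z v that tex)
  (x_measurable : forall k, random_vector (x k))
  (y_measurable : forall k, random_vector (y k.+1))
  (z_measurable : forall k, random_vector (z k.+1))
  (sampling : ~ is_singleton C -> sampling_assumptions P C r Dv Dt x v that) :
  (forall omega,
     (\sum_(0 <= k <oo) ((tex k omega) ^+ 2)%:E < +oo)%E /\
     (tex k omega @[k --> \oo] --> (0 : R))) /\
  {ae P, forall omega, forall xbar : 'rV[R]_n,
     cluster (x k omega @[k --> \oo]) xbar -> d_stationary C h xbar}.
Proof.
split => [w|].
  split; [exact: (run_nneseries_lty C h gamma oracle x y z v that tex)|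
          exact: (run_tex_cvg0 C h gamma oracle x y z v that tex)].
have inC w xbar : cluster (x k w @[k --> \oo]) xbar -> C xbar.
  exact: (run_cluster C h gamma oracle x y z v that tex).
(* The sampling assumptions are available only when [C] is not a singleton. *)
have [Csing|Cns] := pselect (is_singleton C).
  apply: aeW => w xbar /inC; have [a ->] := Csing => ->.
  exact: d_stationary_singleton.
have S := sampling Cns.
have sphere_ae := ae_sphere_in P C r Dv Dt x v that S.
(* The null set must not depend on [xbar], so hits are secured for all rational balls and intervals
   at once. *)
have hits_ae := ae_forall_countable P _
  (fun (i : ('rV[rat]_n * rat) * ('rV[rat]_n * rat) * (rat * rat)) w =>
     (0 < Dv (rational_ball i.1.2))%E ->
     0 < ratr i.2.1 :> R -> ratr i.2.1 < ratr i.2.2 :> R ->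
     ratr i.2.2 <= r ->
     (forall K, exists2 k, (K <= k)%N & rational_ball i.1.1 (x k w)) ->
     forall K, exists2 k, (K <= k)%N & rational_ball i.1.1 (x k w) /\
       rational_ball i.1.2 (v k w) /\
       `[ratr i.2.1, ratr i.2.2]%classic (that k w)) _.
apply: filterS2 sphere_ae (hits_ae _) => [w Sv hits xbar xcl|]; last first.
  move=> [[qU qV] [a b]] /=.
  have [V0|] := pselect (0 < Dv (rational_ball qV))%E; last first.
    by move=> nV0; apply: aeW => w /nV0.
  have [[a0 ab br]|nab] := pselect [/\ 0 < ratr a :> R, ratr a < ratr b :> R &
      ratr b <= r]; last first.
    by apply: aeW => w _ a0 ab br; case: nab.
  have := ae_sampled_infinitely_often P C r Dv Dt x v that x_measurable S
    (rational_ball qU) (rational_ball qV) `[ratr a, ratr b]%classic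
    (measurable_rational_ball _) (measurable_rational_ball _)
    (measurable_itv _) V0 (Dt_pos S a0 ab br).
  by apply: filterS => w.
have Cx := inC _ _ xcl; split => // u fu.
rewrite leNgt; apply/negP => u0.
have [v0 [t0 [U [V [T [[Sv0 /andP[t00 t0r]] xU vV tT UVT]]]]]] :=
  exists_descent_neighborhoods C h xbar u gamma r C_convex h_loc_lip
    (h_dir_deriv _ _ Cx) r_gt0 Cx fu u0.
have [qU qUx qUU] := nbhs_rational_ball _ _ xU.
have [qV qVv qVV] := nbhs_rational_ball _ _ vV.
(* Intersecting with []0, r[] places the rational bounds where [Dt_pos] applies. *)
have [e /= e0 eT] : nbhs_ball t0 (T `&` `]0, r[%classic).
  apply/nbhs_ballP; apply: filterI => //.
  by apply: near_in_itvoo; rewrite in_itv/= t00.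
have [a] := @rat_in_itvoo R (t0 - e) t0 ltac:(by rewrite ltrBlDr ltrDl).
have [b] := @rat_in_itvoo R t0 (t0 + e) ltac:(by rewrite ltrDl).
rewrite !in_itv/= => /andP[t0b bt0] /andP[at0 t0a].
have abT s : ratr a <= s <= ratr b -> T s /\ 0 < s < r.
  move=> /andP[as_ sb].
  have [|Ts] := eT s; first by rewrite /ball/= ltr_distlC; apply/andP; split; lra.
  by rewrite /= in_itv.
have a0 : 0 < ratr a :> R by have [|_ /andP[]//] := abT (ratr a); lra.
have br : ratr b <= r by have [|_ /andP[_ /ltW]//] := abT (ratr b); lra.
have ab : ratr a < ratr b :> R by lra.
(* [v0] is on the sphere, which is the support of [Dv], so open sets around it have mass. *)
have V0 : (0 < Dv (rational_ball qV))%E.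
  have : measure_support (Dv : set 'rV[R]_n -> \bar R) v0.
    by rewrite (Dv_support S).
  by apply; [exact: open_rational_ball|].
(* Every tail of the sequence meets each neighborhood of an accumulation point. *)
have xio K : exists2 k, (K <= k)%N & rational_ball qU (x k w).
  have [|_ [[k Kk <-] qUk]] := xcl (x^~ w @` [set k | (K <= k)%N])
    (rational_ball qU) _ (open_nbhs_nbhs (conj (open_rational_ball _) qUx)).
    by exists K => // k Kk; exists k.
  by exists k.
have tex0 := run_tex_cvg0 C h gamma oracle x y z v that tex gamma_gt0
  oracle_feasible x_run h_bounded_below w.
have [K _ texa] : \forall k \near \oo, tex k w < ratr a.
  exact: cvgr_lt tex0 _ a0.
have [k Kk [Uk [Vk /= tk]]] := hits (qU, qV, (a, b)) V0 a0 ab br xio K.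
move: tk; rewrite in_itv/= => tk.
have [Tk _] := abT _ tk.
have Ck := run_feasible C h gamma oracle x y z v that tex oracle_feasible x_run k w.
have step := UVT _ _ _ (qUU _ Uk) (qVV _ Vk) Tk Ck (Sv k).1.
(* The trial at time [k] is accepted, so the step is [that k w], at least [ratr a], although steps
   from [K] on are smaller. *)
have := texa k Kk; rewrite (run_tex x_run) asboolF// asboolT//.
by case/andP: tk => + _ => /le_lt_trans/[apply]; rewrite ltxx.
Unshelve. all: by end_near. Qed.
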